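(* For every integer $p\geq 0$ there exists a topological graph $\mathcal{G}$ with $P_h(\mathcal{G})=\{p,p+1,p+2,\ldots\}\cup\{+\infty\}$.
   Context: A topological graph is a compact connected metric space which is a finite union of arcs (spaces homeomorphic to $[0,1]$; the points corresponding to $0,1$ are the end points) such that any two of these arcs intersect in at most their end points. For a topological space $A$, $Homeo(A)$ denotes the group of all homeomorphisms $A\to A$ under composition. For a subgroup $G$ of $Homeo(A)$ (acting by $gx=g(x)$), a nonempty subset $Y\subseteq A$ is invariant if $g(y)\in Y$ for all $g\in G$, $y\in Y$. The height of $(G,A)$ is $h(G,A)=\sup\{n\geq 0:$ there exist distinct closed invariant subsets $Y_0\subset Y_1\subset\cdots\subset Y_n=A\}$ (possibly $+\infty$). Finally $P_h(A)=\{h(G,A): G \text{ is a subgroup of } Homeo(A)\}$, i.e. the set of heights of all transformation groups with phase space $A$. *)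

(* Defs.v *)
From HB Require Import structures.
From mathcomp Require Import all_boot all_order all_algebra.
From mathcomp Require Import all_classical all_reals all_analysis.
Set Implicit Arguments. Unset Strict Implicit. Unset Printing Implicit Defensive.
Import Order.TTheory GRing.Theory Num.Theory.
Import numFieldNormedType.Exports.
Local Open Scope classical_set_scope.
Local Open Scope ring_scope.

Definition is_arc (R : realType) (T : topologicalType) (A : set T)
    (gam : R -> T) : Prop :=
  exists inv : T -> R,
    {within `[0, 1], continuous gam} /\
    {within A, continuous inv} /\
    gam @` `[0, 1] = A /\
    inv @` A `<=` `[0, 1] /\
    (forall t, t \in `[0, 1] -> inv (gam t) = t) /\
    (forall x, A x -> gam (inv x) = x).

Definition arc_ends (R : realType) (T : Type) (gam : R -> T) : set T :=
  [set gam 0; gam 1].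

Definition topological_graph (R : realType) (T : pseudoMetricType R) : Prop :=
  hausdorff_space T /\ compact [set: T] /\ connected [set: T] /\
  exists (n : nat) (A : 'I_n -> set T) (gam : 'I_n -> R -> T),
    (0 < n)%N /\
    (forall i, is_arc (A i) (gam i)) /\
    \bigcup_(i in [set: 'I_n]) A i = [set: T] /\
    (forall i j, i != j ->
       A i `&` A j `<=` arc_ends (gam i) `&` arc_ends (gam j)).

Definition homeomorphism (T : topologicalType) (f : T -> T) : Prop :=
  continuous f /\
  exists g : T -> T, continuous g /\ cancel f g /\ cancel g f.

Definition homeo_subgroup (T : topologicalType) (G : set (T -> T)) : Prop :=
  (forall f, G f -> homeomorphism f) /\
  G id /\
  (forall f g, G f -> G g -> G (f \o g)) /\
  (forall f, G f -> exists g, G g /\ cancel f g /\ cancel g f).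

Definition invariant (T : Type) (G : set (T -> T)) (Y : set T) : Prop :=
  Y !=set0 /\ forall g y, G g -> Y y -> Y (g y).

Definition has_chain (T : topologicalType) (G : set (T -> T)) (n : nat) : Prop :=
  exists Y : nat -> set T,
    (forall i, (i <= n)%N -> closed (Y i) /\ invariant G (Y i)) /\
    (forall i, (i < n)%N -> Y i `<` Y i.+1) /\
    Y n = [set: T].

(* heights take values in nat ∪ {+oo}; None stands for +oo.
   height_is G h  <->  h(G,T) = h, where h(G,T) is the supremum of the
   lengths n of chains as above. *)
Definition height_is (T : topologicalType) (G : set (T -> T)) (h : option nat)
  : Prop :=
  match h with
  | None => forall n, has_chain G n
  | Some m => has_chain G m /\ forall n, has_chain G n -> (n <= m)%N
  end.

Definition in_Ph (T : topologicalType) (h : option nat) : Prop :=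
  exists G : set (T -> T), homeo_subgroup G /\ height_is G h.

(* Main.v *)
Require Import Defs.
From mathcomp Require Import all_boot all_order all_algebra.
From mathcomp Require Import all_classical all_reals all_analysis.
From mathcomp Require Import zify ring lra.
Set Implicit Arguments. Unset Strict Implicit. Unset Printing Implicit Defensive.
Import Order.TTheory GRing.Theory Num.Theory.
Import numFieldNormedType.Exports.
Local Open Scope classical_set_scope.
Local Open Scope ring_scope.

(** The graph is the necklace of [k = p + 1] circles in a row, consecutive ones
    being tangent.  Up to the reflections of the necklace it is an interval, and
    its full homeomorphism group has [k] orbits: the tangency points are exactly
    the cut points, and counting them on each side of a cut point shows that the
    distance to the nearest end of the necklace is an invariant.  Hence every
    group has height at least [k - 1 = p].  Marking [m] further levels on the
    two end circles and taking all homeomorphisms that preserve the marks gives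
    a group with [k + m] orbits; sorting the orbits (points first, then arcs)
    gives a chain of closed unions of orbits, so its height is [p + m].  For
    [p = 0], the group of all homeomorphisms of the single circle is transitive;
    and the trivial group has infinite height in all cases. *)

(** * Heights of groups defined by an invariant labelling *)

Section height.
Variable T : topologicalType.
Implicit Types (G : set (T -> T)) (l : T -> nat).

Lemma homeomorphism_id : homeomorphism (@id T).
Proof.
by split=> [x|]; [exact: cvg_id|exists id; split=> // x; exact: cvg_id].
Qed.

Lemma homeomorphism_comp (f g : T -> T) :
  homeomorphism f -> homeomorphism g -> homeomorphism (f \o g).
Proof.
move=> [cf [f' [cf' [fK f'K]]]] [cg [g' [cg' [gK g'K]]]]; split.
  by move=> x; apply: continuous_comp; [exact: cg | exact: cf].
exists (g' \o f'); split; last by split; exact: can_comp.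
by move=> x; apply: continuous_comp; [exact: cf' | exact: cg'].
Qed.

Definition label_group l : set (T -> T) :=
  [set g | homeomorphism g /\ forall z, l (g z) = l z].

Lemma label_group_id l : label_group l id.
Proof. by split=> //; exact: homeomorphism_id. Qed.

Lemma label_group_comp l f g :
  label_group l f -> label_group l g -> label_group l (f \o g).
Proof.
move=> [hf lf] [hg lg]; split; first exact: homeomorphism_comp.
by move=> z /=; rewrite lf lg.
Qed.

Lemma label_group_inv l f : label_group l f ->
  exists g, label_group l g /\ cancel f g /\ cancel g f.
Proof.
move=> [[cf [g [cg [fK gK]]]] lf]; exists g; split=> //; split.
  by split=> //; exists f.
by move=> z; rewrite -{2}(gK z) lf.
Qed.

Lemma homeo_subgroup_label_group l : homeo_subgroup (label_group l).
Proof.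
split; first by move=> f [].
split; first exact: label_group_id.
split; first by move=> f g; exact: label_group_comp.
exact: label_group_inv.
Qed.

Lemma homeo_subgroup1 : homeo_subgroup [set @id T].
Proof.
split; first by move=> f ->; exact: homeomorphism_id.
split=> //; split; first by move=> f g -> ->.
by move=> f ->; exists id.
Qed.

Definition same_orbit l z w := exists2 g, label_group l g & g z = w.

Lemma same_orbit_refl l z : same_orbit l z z.
Proof. by exists id => //; exact: label_group_id. Qed.

Lemma same_orbit_sym l z w : same_orbit l z w -> same_orbit l w z.
Proof.
move=> [f /label_group_inv[g [lg [fK gK]]] <-].
by exists g.
Qed.

Lemma same_orbit_trans l z w v :
  same_orbit l z w -> same_orbit l w v -> same_orbit l z v.
Proof.
by move=> [f lf <-] [g lg <-]; exists (g \o f) => //; exact: label_group_comp.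
Qed.

Lemma same_orbit_label l z w : same_orbit l z w -> l w = l z.
Proof. by move=> [g [_ lg] <-]. Qed.

Lemma has_chainS G n : has_chain G n.+1 -> has_chain G n.
Proof.
move=> [Y [cY [sY YT]]]; exists (Y \o S); split; first by move=> i; exact: (cY i.+1).
by split=> // i; exact: (sY i.+1).
Qed.

Lemma has_chain_leq G m n : (m <= n)%N -> has_chain G n -> has_chain G m.
Proof.
move=> /subnK <-; elim: (n - m)%N => //= k IH h; apply: IH.
exact: has_chainS.
Qed.

(** The sublevel sets of [l] form the chain. Asking only that [G] never raise labels lets the lemma
    serve both for label groups and for an arbitrary group on the necklace. *)
Lemma has_chain_label G l n : (forall g z, G g -> (l (g z) <= l z)%N) ->
  (forall c, closed [set z | (l z <= c)%N]) ->
  (forall c, (c <= n)%N -> exists z, l z = c) -> (forall z, (l z <= n)%N) ->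
  has_chain G n.
Proof.
move=> Gl cl sl ln; exists (fun c => [set z | (l z <= c)%N]); split.
  move=> c cn; split; first exact: cl.
  split; first by have [z <-] := sl _ cn; exists z => /=.
  by move=> g z Gg /= zc; apply: leq_trans zc; exact: Gl.
split; last by apply/seteqP; split=> // z _ /=.
move=> c cn; split=> [z /= zc|]; first exact: leqW.
by have [z zc] := sl _ cn => /(_ z); rewrite /= zc leqnn ltnn => /(_ isT).
Qed.

(** Choose in each member of the chain a point outside the previous ones. Two such points lie in
    different orbits, hence carry different labels, and only [n.+1] labels are available. *)
Lemma has_chain_label_le l n m : (forall z w, l z = l w -> same_orbit l z w) ->
  (forall z, (l z <= n)%N) -> has_chain (label_group l) m -> (m <= n)%N.
Proof.
move=> orb ln [Y [cY [sY YT]]].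
have mono i j : (i <= j <= m)%N -> Y i `<=` Y j.
  move=> /andP[/subnK <-]; elim: (j - i)%N => [_|d IH dm] z Yz //.
  by have [+ _] := sY _ dm; apply; apply: IH => //; exact: ltnW.
have ex (i : 'I_m.+1) : exists z, Y i z /\ forall j, (j < i)%N -> ~ Y j z.
  case: i => -[|i] im /=.
    by have [_ [[y Yy] _]] := cY _ (leq0n _); exists y.
  have [_ /existsNP[z /not_implyP[Yz nYz]]] := sY _ im; exists z; split=> // j ji.
  by apply: contra_not nYz; apply: mono; rewrite -ltnS ji -ltnS ltnW.
have [f fP] := choice ex.
have f_inj : injective (fun i : 'I_m.+1 => (inord (l (f i)) : 'I_n.+1)).
  suff lt (i j : 'I_m.+1) : (i < j)%N -> l (f i) <> l (f j).
    move=> i j /(congr1 val); rewrite /= !inordK ?ltnS // => eqf.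
    apply/val_inj => /=; case: (ltngtP i j) => // [/lt|/lt] //.
    by rewrite eqf.
  move=> ij /orb [g lg gfi]; have [Yj /(_ _ ij)] := fP j.
  apply; rewrite -gfi.
  have [_ [_]] := cY i (ltn_ord i); apply=> //.
  by have [] := fP i.
by have := leq_card _ f_inj; rewrite !card_ord.
Qed.

Lemma label_height l n :
  (forall c, closed [set z | (l z <= c)%N]) ->
  (forall c, (c <= n)%N -> exists z, l z = c) -> (forall z, (l z <= n)%N) ->
  (forall z w, l z = l w -> same_orbit l z w) ->
  height_is (label_group l) (Some n).
Proof.
move=> cl sl ln orb; split; last by move=> m; exact: has_chain_label_le.
by apply: (@has_chain_label _ l) => // g z [_ ->].
Qed.

End height.

(** A continuous map from a compact set onto a Hausdorff space is closed, hence a quotient map: the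
    preimage of [C] under [f] is the image of a compact set. *)
Lemma continuous_quotient (K T U : topologicalType) (q : K -> T) (f : T -> U)
    (A : set K) : hausdorff_space T -> compact A -> continuous q ->
  (forall z, exists2 t, A t & q t = z) -> continuous (f \o q) -> continuous f.
Proof.
move=> hT cA cq sq cfq; apply/continuous_closedP => C cC.
have -> : f @^-1` C = q @` (A `&` (f \o q) @^-1` C).
  apply/seteqP; split=> [z Cz|_ [t [_ Ct] <-]] //.
  by have [t At qt] := sq z; exists t => //; split=> //=; rewrite qt.
apply: compact_closed => //; apply: continuous_compact.
  exact: continuous_subspaceT.
apply: compact_closedI => //.
by move/continuous_closedP: cfq; apply.
Qed.

(** * Homeomorphisms of the line supported in an interval *)

Section interval_push.
Variables (R : realType) (a b : R).
Hypothesis ab : a < b.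

Let clip (s : R) : R := Num.max 0 (Num.min ((s - a) / (b - a)) 1).

(* The Moebius map u |-> lam u / (1 - u + lam u) is an increasing
   homeomorphism of [0, 1] whose inverse is the one with parameter 1 / lam. *)
Let mob (lam u : R) : R := lam * u / (1 - u + lam * u).
(** The displacement form gives the identity wherever [clip] is 0 or 1, and continuity on the whole
    line without gluing pieces. *)
Let push (lam s : R) : R := s + (b - a) * (mob lam (clip s) - clip s).

Let ba0 : 0 < b - a. Proof. by rewrite subr_gt0. Qed.

Let scaleK x : (b - a) * (x / (b - a)) = x.
Proof. by rewrite mulrC mulfVK ?gt_eqF. Qed.

Let clip_bounds s : 0 <= clip s <= 1.
Proof. by rewrite /clip le_max lexx/= ge_max ler01/= ge_min lexx orbT. Qed.

Let den_gt0 (lam u : R) : 0 < lam -> 0 <= u <= 1 -> 0 < 1 - u + lam * u.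
Proof. by move=> l0 /andP[u0 u1]; nra. Qed.

Let clip_in s : a < s < b -> clip s = (s - a) / (b - a).
Proof.
move=> /andP[sa sb]; rewrite /clip min_l ?max_r//.
  by rewrite divr_ge0// subr_ge0 ltW.
by rewrite ler_pdivrMr// mul1r lerD2r ltW.
Qed.

Let clip_lt s : s <= a -> clip s = 0.
Proof.
move=> sa; rewrite /clip max_l// ge_min; apply/orP; left.
by rewrite ler_pdivrMr// mul0r subr_le0.
Qed.

Let clip_gt s : b <= s -> clip s = 1.
Proof.
by move=> sb; rewrite /clip min_r ?max_r// ler_pdivlMr// mul1r lerD2r.
Qed.

Let push_out (lam s : R) : 0 < lam -> ~~ (a < s < b) -> push lam s = s.
Proof.
move=> l0; rewrite negb_and -!leNgt /push /mob => /orP[/clip_lt|/clip_gt] ->.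
  by rewrite mulr0 mul0r subrr mulr0 addr0.
by rewrite subrr add0r !mulr1 divff ?gt_eqF// subrr mulr0 addr0.
Qed.

Let push_in lam s : a < s < b ->
  push lam s = a + (b - a) * mob lam ((s - a) / (b - a)).
Proof.
move=> sab; rewrite /push clip_in// mulrBr scaleK.
by ring.
Qed.

Let mob_bounds (lam u : R) : 0 < lam -> 0 < u < 1 -> 0 < mob lam u < 1.
Proof.
move=> l0 /andP[u0 u1]; have d0 : 0 < 1 - u + lam * u by nra.
rewrite /mob divr_gt0//=; last by rewrite mulr_gt0.
by rewrite ltr_pdivrMr// mul1r ltrDr subr_gt0.
Qed.

Let mobK (lam u : R) : 0 < lam -> 0 < u < 1 -> mob lam^-1 (mob lam u) = u.
Proof.
move=> l0 /andP[u0 u1]; have d0 : 0 < 1 - u + lam * u by nra.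
have e : 1 - lam * u / (1 - u + lam * u) + lam^-1 * (lam * u / (1 - u + lam * u))
   = (1 - u + lam * u)^-1.
  by field; rewrite !gt_eqF.
rewrite /mob e invrK mulrA mulrA mulVf ?gt_eqF// mul1r.
by rewrite mulfVK ?gt_eqF.
Qed.

Let frac_in s : a < s < b -> 0 < (s - a) / (b - a) < 1.
Proof.
move=> /andP[sa sb]; rewrite divr_gt0 ?subr_gt0//=.
by rewrite ltr_pdivrMr// mul1r ltrD2r.
Qed.

Let push_stable (lam s : R) : 0 < lam -> a < s < b -> a < push lam s < b.
Proof.
move=> l0 sab; rewrite push_in//.
by have /andP[m0 m1] := mob_bounds l0 (frac_in sab); apply/andP; split; nra.
Qed.

Let pushK (lam : R) : 0 < lam -> cancel (push lam) (push lam^-1).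
Proof.
move=> l0 s; have li0 : 0 < lam^-1 by rewrite invr_gt0.
case: (boolP (a < s < b)) => sab; last by rewrite !push_out.
rewrite push_in; last exact: push_stable.
rewrite push_in//.
have -> x : (a + (b - a) * x - a) / (b - a) = x.
  by rewrite addrAC subrr add0r [X in X / _]mulrC mulfK ?gt_eqF.
by rewrite mobK ?frac_in// scaleK addrC subrK.
Qed.

Let push_continuous (lam : R) : 0 < lam -> continuous (push lam).
Proof.
move=> l0 s.
have cc : {for s, continuous clip}.
  apply: (@continuous_max _ _ (fun=> 0 : R)); first exact: cvg_cst.
  apply: (@continuous_min _ _ (fun s => (s - a) / (b - a)) (fun=> 1 : R)).
    by apply: cvgM; [apply: cvgB; [exact: cvg_id|exact: cvg_cst]|exact: cvg_cst].
  exact: cvg_cst.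
apply: cvgD; first exact: cvg_id.
apply: cvgM; first exact: cvg_cst.
apply: cvgB => //.
apply: cvgM; first by apply: cvgM => //; exact: cvg_cst.
apply: cvgV; first by rewrite gt_eqF// den_gt0.
apply: cvgD; first by apply: cvgB => //; exact: cvg_cst.
by apply: cvgM => //; exact: cvg_cst.
Qed.

Lemma interval_push (t t' : R) : a < t < b -> a < t' < b ->
  exists f g : R -> R, [/\ continuous f, continuous g, cancel f g & cancel g f]
    /\ [/\ f t = t', forall s, a < s < b -> a < f s < b
      & forall s, ~~ (a < s < b) -> f s = s].
Proof.
move=> tab tab'; have /andP[u0 u1] := frac_in tab.
have /andP[v0 v1] := frac_in tab'.
set u := _ / _ in u0 u1; set v := (t' - a) / (b - a) in v0 v1.
(* The Moebius map multiplies the odds u / (1 - u) by its parameter, so [lam] is the odds of [v]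
   divided by the odds of [u]. *)
pose lam := v * (1 - u) / (u * (1 - v)).
have l0 : 0 < lam by rewrite divr_gt0// mulr_gt0// subr_gt0.
exists (push lam), (push lam^-1); split; split.
- exact: push_continuous.
- by apply: push_continuous; rewrite invr_gt0.
- exact: pushK.
- by rewrite -{2}(invrK lam); apply: pushK; rewrite invr_gt0.
- rewrite push_in// -/u.
  suff -> : mob lam u = v.
    by rewrite /v scaleK addrC subrK.
  have nu : u != 0 by rewrite gt_eqF.
  have nv : 1 - v != 0 by rewrite subr_eq0 gt_eqF.
  have nw : 1 - u != 0 by rewrite subr_eq0 gt_eqF.
  have e : 1 - u + lam * u = (1 - u) / (1 - v) by rewrite /lam; field; rewrite nv nu.
  by rewrite /mob e /lam; field; rewrite nv nw nu.
- by move=> s; exact: push_stable.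
- by move=> s; exact: push_out.
Qed.

End interval_push.

(** * The necklace *)

Lemma injective_hausdorff (T U : topologicalType) (f : T -> U) :
  injective f -> continuous f -> hausdorff_space U -> hausdorff_space T.
Proof.
move=> fI cf hU x y xy; apply: fI; apply: hU => A B fxA fyB.
by have [z [Az Bz]] := xy _ _ (cf _ _ fxA) (cf _ _ fyB); exists (f z).
Qed.

Section necklace.
Variables (R : realType) (k : nat).

(** The curve follows the graph of x |x - 1| ... |x - k| over [0, k] and the opposite graph, the
    sign of [t] choosing the branch. The two meet exactly at the integers, so each unit interval
    carries one circle. *)
Definition necklace_curve (t : R) : R * R :=
  (`|t|, t * \prod_(1 <= i < k.+1) `| `|t| - i%:R|).

Definition necklace_set : set (R * R) :=
  necklace_curve @` [set t | `|t| <= k%:R].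

Definition necklace : pseudoMetricType R := set_type necklace_set.

(** Extends the parametrization from [-k, k] to the line, so that [gam] is total and continuous. *)
Definition clamp (t : R) : R := Num.max (- k%:R) (Num.min t k%:R).

Lemma clamp_bound t : `|clamp t| <= k%:R.
Proof.
rewrite ler_norml /clamp le_max lexx ge_max ge_min lexx orbT andbT /=.
by rewrite (le_trans (_ : _ <= 0)) ?oppr_le0.
Qed.

Lemma clamp_id t : `|t| <= k%:R -> clamp t = t.
Proof. by rewrite ler_norml /clamp => /andP[? ?]; rewrite min_l// max_r. Qed.

Lemma clamp_continuous : continuous clamp.
Proof.
move=> t; suff : {for t, continuous clamp} by [].
apply: (@continuous_max _ _ (fun=> - k%:R : R)); first exact: cvg_cst.
apply: (@continuous_min _ _ id (fun=> k%:R : R)); first exact: cvg_id.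
exact: cvg_cst.
Qed.

Lemma necklace_point_subproof t : necklace_curve (clamp t) \in necklace_set.
Proof. by apply/mem_set; exists (clamp t) => //; exact: clamp_bound. Qed.

(* gam runs from the right end of the necklace to its left end and back; it is
   injective on [-k, k] except that gam i = gam (- i) for i = 1, ..., k. *)
Definition gam (t : R) : necklace :=
  exist _ (necklace_curve (clamp t)) (necklace_point_subproof t).

Definition abscissa (z : necklace) : R := (set_val z).1.

Lemma necklace_curve_continuous : continuous necklace_curve.
Proof.
move=> t.
have cp : {for t, continuous
    (fun t : R => \prod_(1 <= i < k.+1) `| `|t| - i%:R| : R)}.
  apply: (cvg_big (@mul_continuous R)) => i _.
  apply: cvg_norm; apply: cvgB; last exact: cvg_cst.
  exact: norm_continuous.
have cs : {for t, continuous
    (fun t : R => t * \prod_(1 <= i < k.+1) `| `|t| - i%:R| : R)}.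
  by apply: cvgM => //; exact: cvg_id.
exact: (cvg_pair (@norm_continuous _ R t) cs).
Qed.

Lemma gam_continuous : continuous gam.
Proof.
apply: continuous_comp_initial => t.
apply: (@continuous_comp _ _ _ clamp necklace_curve).
  exact: clamp_continuous.
exact: necklace_curve_continuous.
Qed.

Lemma abscissa_continuous : continuous abscissa.
Proof.
move=> z; apply: (@continuous_comp _ _ _ (set_val : necklace -> R * R) fst).
  exact: initial_continuous.
exact: cvg_fst.
Qed.

Lemma abscissa_gam t : `|t| <= k%:R -> abscissa (gam t) = `|t|.
Proof. by move=> tk; rewrite /abscissa set_valE /= clamp_id. Qed.

Lemma gam_surj z : exists2 t, `|t| <= k%:R & gam t = z.
Proof.
case: z => w hw; have [t tk tw] := set_mem hw; exists t => //.
by apply: val_inj; rewrite /= clamp_id.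
Qed.

Lemma abscissa_bound z : 0 <= abscissa z <= k%:R.
Proof. by have [t tk <-] := gam_surj z; rewrite abscissa_gam// normr_ge0. Qed.

Lemma prod_dist_eq0 (x : R) :
  reflect (exists2 i, (0 < i <= k)%N & x = i%:R)
          (\prod_(1 <= i < k.+1) `|x - i%:R| == 0).
Proof.
rewrite prodf_seq_eq0; apply: (iffP hasP) => [[i]|[i ik ->]].
  rewrite mem_index_iota ltnS normr_eq0 subr_eq0 => ik /eqP.
  by exists i.
by exists i; rewrite ?mem_index_iota ?ltnS//= subrr normr0.
Qed.

(** Equal abscissas give equal absolute values; the common product then either vanishes, at an
    integer abscissa, or cancels from the ordinates. *)
Lemma gam_eq t t' : `|t| <= k%:R -> `|t'| <= k%:R -> gam t = gam t' ->
  t = t' \/ t' = - t /\ exists2 i, (0 < i <= k)%N & `|t| = i%:R.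
Proof.
move=> tk tk' /(congr1 set_val); rewrite !set_valE /= !clamp_id// => -[e].
rewrite -e; case: (boolP (\prod_(1 <= i < k.+1) `| `|t| - i%:R| == 0)).
  move=> /prod_dist_eq0 Pt _; move/eqP: e.
  rewrite eqr_norm2 => /orP[|] /eqP et; first by left.
  by right; rewrite [in t' = _]et opprK.
by move=> nP /(mulIf nP); left.
Qed.

Lemma gam_opp t i : (i <= k)%N -> `|t| = i%:R -> gam (- t) = gam t.
Proof.
move=> ik ti; apply: val_inj; rewrite /= !clamp_id ?normrN ?ti ?ler_nat//.
rewrite /necklace_curve normrN; congr pair.
have [i0|i0] := posnP i.
  by move/eqP: ti; rewrite i0 normr_eq0 => /eqP ->; rewrite oppr0.
suff /eqP -> : \prod_(1 <= i < k.+1) `| `|t| - i%:R| == 0 by rewrite !mulr0.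
by apply/prod_dist_eq0; exists i; rewrite ?i0.
Qed.

Lemma necklace_hausdorff : hausdorff_space necklace.
Proof.
apply: (@injective_hausdorff _ _ (set_val : necklace -> R * R)).
- exact: val_inj.
- exact: initial_continuous.
- exact: norm_hausdorff.
Qed.

Lemma segment_of_norm : [set t : R | `|t| <= k%:R] = `[- k%:R, k%:R]%classic.
Proof. by apply/seteqP; split=> t /=; rewrite in_itv/= ler_norml. Qed.

Lemma necklace_quotient (U : topologicalType) (f : necklace -> U) :
  continuous (f \o gam) -> continuous f.
Proof.
apply: (@continuous_quotient _ _ _ gam f `[- k%:R, k%:R]%classic).
- exact: necklace_hausdorff.
- exact: segment_compact.
- exact: gam_continuous.
- by move=> z; have [t tk] := gam_surj z; exists t => //; rewrite -segment_of_norm.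
Qed.

Lemma gamT : gam @` `[- k%:R, k%:R] = [set: necklace].
Proof.
apply/seteqP; split=> // z _; have [t tk tz] := gam_surj z.
by exists t => //; rewrite -segment_of_norm.
Qed.

Lemma necklace_compact : compact [set: necklace].
Proof.
rewrite -gamT; apply: continuous_compact; last exact: segment_compact.
exact/continuous_subspaceT/gam_continuous.
Qed.

Lemma necklace_connected : connected [set: necklace].
Proof.
rewrite -gamT; apply: connected_continuous_connected.
  exact: segment_connected.
exact/continuous_subspaceT/gam_continuous.
Qed.

(** * Symmetries of the necklace *)

Lemma mul_prod_dist (x : R) : 0 <= x ->
  x * \prod_(1 <= i < k.+1) `|x - i%:R| = \prod_(0 <= i < k.+1) `|x - i%:R|.
Proof. by move=> x0; rewrite [RHS]big_nat_recl// subr0 ger0_norm// big_add1. Qed.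

(** Reversing the order of the indices exchanges x and k - x. The factor of index 0, which is the
    leading x of the curve, is what makes the product symmetric. *)
Lemma prod_dist_flip (x : R) :
  \prod_(0 <= i < k.+1) `|k%:R - x - i%:R| = \prod_(0 <= i < k.+1) `|x - i%:R|.
Proof.
rewrite big_nat_rev /=; apply: eq_big_nat => i /andP[_ ik].
rewrite add0n subSS natrB// distrC; congr `|_|; lra.
Qed.

Lemma flip_subproof (z : necklace) :
  (k%:R - (set_val z).1, (set_val z).2) \in necklace_set.
Proof.
apply/mem_set; have [t tk <-] := gam_surj z; rewrite set_valE /= clamp_id//.
have kt0 : 0 <= k%:R - `|t| by rewrite subr_ge0.
have ktk : k%:R - `|t| <= k%:R by rewrite gerBl.
have Q := prod_dist_flip `|t|; rewrite -!mul_prod_dist// in Q.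
have [t0|t0] := leP 0 t.
  exists (k%:R - `|t|); first by rewrite /= ger0_norm.
  by rewrite /necklace_curve (ger0_norm kt0) Q (ger0_norm t0).
exists (- (k%:R - `|t|)); first by rewrite /= normrN ger0_norm.
by rewrite /necklace_curve normrN (ger0_norm kt0) mulNr Q (ltr0_norm t0) mulNr !opprK.
Qed.

Definition flip (z : necklace) : necklace := 
  exist _ (k%:R - (set_val z).1, (set_val z).2) (flip_subproof z).

Lemma mirror_subproof (z : necklace) :
  ((set_val z).1, - (set_val z).2) \in necklace_set.
Proof.
apply/mem_set; have [t tk <-] := gam_surj z; rewrite set_valE /= clamp_id//.
by exists (- t); rewrite /= /necklace_curve normrN// mulNr.
Qed.

Definition mirror (z : necklace) : necklace := 
  exist _ ((set_val z).1, - (set_val z).2) (mirror_subproof z).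

Lemma flipK : involutive flip.
Proof. by move=> z; apply: val_inj => /=; rewrite subKr -surjective_pairing. Qed.

Lemma mirrorK : involutive mirror.
Proof. by move=> z; apply: val_inj => /=; rewrite opprK -surjective_pairing. Qed.

Lemma abscissa_flip z : abscissa (flip z) = k%:R - abscissa z.
Proof. by []. Qed.

Lemma mirror_gam t : `|t| <= k%:R -> mirror (gam t) = gam (- t).
Proof.
move=> tk; apply: val_inj; rewrite /= !clamp_id ?normrN//.
by rewrite /necklace_curve normrN mulNr.
Qed.

Lemma set_val_continuous : continuous (set_val : necklace -> R * R).
Proof. exact: initial_continuous. Qed.

Lemma ordinate_continuous : continuous (fun z : necklace => (set_val z).2).
Proof.
move=> z; apply: (@continuous_comp _ _ _ (set_val : necklace -> R * R) snd).
  exact: set_val_continuous.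
exact: cvg_snd.
Qed.

Lemma flip_continuous : continuous flip.
Proof.
apply: continuous_comp_initial => z.
have cx : {for z, continuous (fun z : necklace => k%:R - abscissa z)}.
  exact: (continuousB (@cst_continuous _ _ (k%:R : R) z)
    (@abscissa_continuous z)).
exact: (cvg_pair cx (@ordinate_continuous z)).
Qed.

Lemma mirror_continuous : continuous mirror.
Proof.
apply: continuous_comp_initial => z.
have cy : {for z, continuous (fun z : necklace => - (set_val z).2)}.
  exact: (cvgN (@ordinate_continuous z)).
exact: (cvg_pair (@abscissa_continuous z) cy).
Qed.

Lemma homeomorphism_flip : homeomorphism flip.
Proof.
split; first exact: flip_continuous.
by exists flip; split; [exact: flip_continuous|split; exact: flipK].
Qed.

Lemma homeomorphism_mirror : homeomorphism mirror.
Proof.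
split; first exact: mirror_continuous.
by exists mirror; split; [exact: mirror_continuous|split; exact: mirrorK].
Qed.

(** * Decomposition into 2k half circles *)

Definition arc_param (e : nat) (u : R) : necklace := gam (e%:R - k%:R + u).

(** Along an arc the abscissa is affine, decreasing for negative parameters and increasing for
    positive ones, so it provides the inverse. *)
Definition arc_coord (e : nat) (z : necklace) : R :=
  if (e < k)%N then k%:R - e%:R - abscissa z else abscissa z - (e%:R - k%:R).

Lemma arc_range e (u : R) : (e < k + k)%N -> 0 <= u <= 1 ->
  `|e%:R - k%:R + u| <= k%:R.
Proof.
move=> ek u01; have : e.+1%:R <= (k + k)%:R :> R by rewrite ler_nat.
rewrite natrD -natr1 ler_norml => ?.
by have : 0 <= e%:R :> R by []; move=> ?; apply/andP; split; lra.
Qed.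

Lemma arc_param_continuous e : continuous (arc_param e).
Proof.
move=> u; have cu : {for u, continuous (fun u : R => e%:R - k%:R + u : R)}.
  apply: (@continuousD R R R (cst (e%:R - k%:R : R)) id u).
    exact: cst_continuous.
  exact: cvg_id.
exact: (continuous_comp cu (@gam_continuous _)).
Qed.

Lemma arc_paramK e (u : R) : (e < k + k)%N -> 0 <= u <= 1 ->
  arc_coord e (arc_param e u) = u.
Proof.
move=> ek u01; rewrite /arc_coord /arc_param abscissa_gam; last exact: arc_range.
have [ltek|leke] := ltnP e k.
  have : e.+1%:R <= k%:R :> R by rewrite ler_nat.
  by rewrite -natr1 => ?; rewrite ler0_norm; lra.
have : k%:R <= e%:R :> R by rewrite ler_nat.
by move=> ?; rewrite ger0_norm; lra.
Qed.

Lemma is_arc_necklace e : (e < k + k)%N ->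
  is_arc (arc_param e @` `[0, 1]) (arc_param e).
Proof.
move=> ek; have K (u : R) : u \in `[0, 1] -> arc_coord e (arc_param e u) = u.
  by rewrite in_itv => /(arc_paramK ek).
exists (arc_coord e); split; [|split; [|split=> //]].
- apply/continuous_subspaceT/arc_param_continuous.
- apply: continuous_subspaceT => z; rewrite /arc_coord; case: (e < k)%N.
    exact: (continuousB (@cst_continuous _ _ (k%:R - e%:R : R) z)
      (@abscissa_continuous z)).
  exact: (continuousB (@abscissa_continuous z)
    (@cst_continuous _ _ (e%:R - k%:R : R) z)).
- split; first by move=> _ [_ [u u01 <-] <-]; rewrite K.
  by split=> // _ [u u01 <-]; rewrite K.
Qed.

Lemma natr_between (m n : nat) (u : R) : 0 <= u <= 1 -> m%:R + u = n%:R ->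
  u = 0 \/ u = 1.
Proof.
move=> u01 mun; have mn : (m <= n)%N by rewrite -(ler_nat R); lra.
have nm : (n <= m.+1)%N by rewrite -(ler_nat R) -natr1; lra.
have [nE|nE] : n = m \/ n = m.+1 by lia.
  by left; move: mun; rewrite nE; lra.
by right; move: mun; rewrite nE -natr1; lra.
Qed.

Lemma arc_end e (u : R) i : 0 <= u <= 1 ->
  `|e%:R - k%:R + u| = i%:R :> R -> arc_ends (arc_param e) (arc_param e u).
Proof.
move=> u01 ui; suff [->|->] : u = 0 \/ u = 1 by [left|right].
have [x0|x0] := leP 0 (e%:R - k%:R + u).
  apply: (@natr_between e (i + k)) => //.
  by move: ui; rewrite ger0_norm// natrD; lra.
apply: (@natr_between (e + i) k) => //.
by move: ui; rewrite ltr0_norm// natrD; lra.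
Qed.

(** A common point either has the same parameter in both arcs, which are then consecutive, or has
    opposite parameters of integer absolute value, which are ends of their arcs. *)
Lemma arc_meet e e' : (e < k + k)%N -> (e' < k + k)%N -> e != e' ->
  arc_param e @` `[0, 1] `&` arc_param e' @` `[0, 1] `<=`
  arc_ends (arc_param e) `&` arc_ends (arc_param e').
Proof.
move=> ek ek' ee' z [[u +] <-] [u' + eq]; rewrite /= !in_itv /= => u01 u01'.
have [xE|[xE [i _ ui]]] := gam_eq (arc_range ek' u01') (arc_range ek u01) eq.
  have [lt|lt] : (e < e')%N \/ (e' < e)%N by lia.
    have : e.+1%:R <= e'%:R :> R by rewrite ler_nat.
    rewrite -natr1 => ?; have u1 : u = 1 by lra.
    have u0 : u' = 0 by lra.
    by split; [right; rewrite u1|left; rewrite -eq u0].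
  have : e'.+1%:R <= e%:R :> R by rewrite ler_nat.
  rewrite -natr1 => ?; have u1 : u' = 1 by lra.
  have u0 : u = 0 by lra.
  by split; [left; rewrite u0|right; rewrite -eq u1].
split; last by rewrite -eq; exact: (arc_end u01' ui).
by apply: (arc_end u01 (i := i)); rewrite xE normrN.
Qed.

Lemma necklace_graph : (0 < k)%N -> topological_graph necklace.
Proof.
move=> k0; split; first exact: necklace_hausdorff.
split; first exact: necklace_compact.
split; first exact: necklace_connected.
exists (k + k)%N, (fun e => arc_param e @` `[0, 1]), (fun e => arc_param e).
split; first by rewrite addn_gt0 k0.
split; first by move=> e; exact: is_arc_necklace.
split; last by move=> e e' ee'; exact: arc_meet.
apply/seteqP; split=> // z _; have [t + <-] := gam_surj z.
rewrite ler_norml => /andP[kt tk].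
have [tltk|] := ltP t k%:R; last first.
  (* Truncation would give this parameter the index 2k, one too many; it is the end of the last
     arc. *)
  move=> kt'; have -> : t = k%:R by apply/eqP; rewrite eq_le tk.
  have lt : ((k + k).-1 < k + k)%N by lia.
  exists (Ordinal lt) => //=; exists 1; first by rewrite /= in_itv/= lexx ler01.
  rewrite /arc_param; congr gam; rewrite -subn1 natrB ?addn_gt0 ?k0// natrD; lra.
have tk0 : 0 <= t + k%:R by lra.
have := truncn_itv tk0; set e := Num.truncn _ => /andP[et te].
have lt : (e < k + k)%N by rewrite -(ltr_nat R) natrD; lra.
exists (Ordinal lt) => //=; exists (t + k%:R - e%:R).
  by move: te; rewrite /= in_itv/= -natr1 => ?; lra.
by rewrite /arc_param; congr gam; lra.
Qed.

End necklace.

(** * Orbits and labels on the necklace *)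

Section necklace_orbits.
Variables (R : realType) (k : nat).
Local Notation T := (necklace R k).
Local Notation gam := (@gam R k).

Lemma gam_clamp t : gam (clamp k t) = gam t.
Proof. by apply: val_inj; rewrite /= (clamp_id (clamp_bound k t)). Qed.

(** A parameter map descends once it fixes the parameters where [gam] is not injective. The
    parameter 0 is not among them, so the left end may move. *)
Lemma lift_necklace (f : R -> R) : continuous f ->
  (forall t, `|t| <= k%:R -> `|f t| <= k%:R) ->
  (forall t i, (0 < i <= k)%N -> `|t| = i%:R -> f t = t) ->
  exists2 F : T -> T, continuous F &
    forall t, `|t| <= k%:R -> F (gam t) = gam (f t).
Proof.
move=> cf fk ffix.
have ex (z : T) : exists t, `|t| <= k%:R /\ gam t = z.
  by have [t tk tz] := gam_surj z; exists t.
have [sel selP] := choice ex.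
have FE t : `|t| <= k%:R -> gam (f (sel (gam t))) = gam (f t).
  move=> tk; have [sk sE] := selP (gam t).
  have [->//|[tE [i ik si]]] := gam_eq sk tk sE.
  by rewrite !(ffix _ i)// tE normrN.
exists (fun z => gam (f (sel z))) => //.
apply: necklace_quotient => t.
rewrite (_ : _ \o gam = gam \o (f \o clamp k)); last first.
  by apply/funext => s /=; rewrite -(gam_clamp s) FE// clamp_bound.
have cfc : {for t, continuous (f \o clamp k)}.
  by apply: continuous_comp; [exact: clamp_continuous|exact: cf].
exact: (continuous_comp cfc (@gam_continuous R k _)).
Qed.

(** The interval contains no glued parameter, so a push inside it descends to the necklace;
    constancy of [l] there puts the result in the label group. *)
Lemma same_orbit_push (l : T -> nat) (a b t t' : R) :
  (forall s, a < s < b -> `|s| < k%:R) ->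
  (forall s i, a < s < b -> (0 < i)%N -> `|s| != i%:R) ->
  (forall s s', a < s < b -> a < s' < b -> l (gam s) = l (gam s')) ->
  a < t < b -> a < t' < b -> same_orbit l (gam t) (gam t').
Proof.
move=> abk abi abl tab tab'.
have ab : a < b by case/andP: tab; exact: lt_trans.
have [f [g [[cf cg fK gK] [ft fin fout]]]] := interval_push ab tab tab'.
have gout s : ~~ (a < s < b) -> g s = s.
  by move=> sab; rewrite -{1}(fout _ sab) fK.
have gin s : a < s < b -> a < g s < b.
  move=> sab; apply/negPn/negP => nab; move: (nab).
  by rewrite -(fout _ nab) gK sab.
have lift h : continuous h -> (forall s, a < s < b -> a < h s < b) ->
    (forall s, ~~ (a < s < b) -> h s = s) ->
    (forall s, `|s| <= k%:R -> `|h s| <= k%:R) /\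
    exists2 F : T -> T, continuous F &
    forall t, `|t| <= k%:R -> F (gam t) = gam (h t).
  move=> ch hin hout.
  have hk s : `|s| <= k%:R -> `|h s| <= k%:R.
    move=> sk; case: (boolP (a < s < b)) => sab; last by rewrite hout.
    exact/ltW/abk/hin.
  split=> //; apply: lift_necklace => // s i /andP[i0 _] si.
  apply: hout; apply/negP => sab; have := abi _ _ sab i0.
  by rewrite si eqxx.
have [fk [F cF FE]] := lift f cf fin fout.
have [gk [G cG GE]] := lift g cg gin gout.
have FK : cancel F G.
  move=> z; have [s sk <-] := gam_surj z.
  by rewrite FE// GE ?fK//; exact: fk.
have GK : cancel G F.
  move=> z; have [s sk <-] := gam_surj z.
  by rewrite GE// FE ?gK//; exact: gk.
exists F; last by rewrite FE ?ft// ltW// abk.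
split; first by split=> //; exists G.
move=> z; have [s sk <-] := gam_surj z; rewrite FE//.
case: (boolP (a < s < b)) => sab; last by rewrite fout.
by apply: abl => //; exact: fin.
Qed.

Lemma same_orbit_mirror (l : T -> nat) z :
  (forall z w, abscissa z = abscissa w -> l z = l w) ->
  same_orbit l z (mirror z).
Proof.
move=> lx; exists (@mirror R k) => //; split; first exact: homeomorphism_mirror.
by move=> w; exact: lx.
Qed.

End necklace_orbits.

(* The folded necklace is [0, kap], and eps rescales it so that the marked
   levels become the integers 1, ..., F, together with 0 when b holds; c tells
   whether an arc is left beyond the level F. Labels below F + b are marked
   levels and the others are the open arcs between them, so that every set
   {label <= m} is closed. *)
Section label.
Variables (R : realType) (k : nat) (eps : R -> R) (kap : R) (F : nat) (b c : bool).
Hypothesis eps_cont : continuous eps.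
Hypothesis eps0 : eps 0 = 0.
Hypothesis kap_gt0 : 0 < kap.
Hypothesis kap_le : kap <= k%:R.
Hypothesis eps_mono : forall x y : R, 0 <= x -> x < y -> y <= kap -> eps x < eps y.
Hypothesis eps_kap : eps kap = F%:R + c%:R / 2.
(** Either only [mirror] folds the necklace, onto [0, k], or [flip] folds it further onto
    [0, k / 2]. *)
Hypothesis eps_sym : kap = k%:R \/
  (kap *+ 2 = k%:R /\ forall x, eps (k%:R - x) = eps x).
(** Pushes stay away from glued points. The tangency points and, if [flip] does not fold, the point
    of abscissa k must therefore sit at marked levels. *)
Hypothesis eps_end : kap = k%:R -> ~~ c.
Hypothesis eps_int : forall i, (0 < i < k)%N ->
  exists2 j, (0 < j)%N & eps i%:R = j%:R.

Local Notation T := (necklace R k).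
Local Notation gam := (@gam R k).

Definition height_fun (z : T) : R := eps (abscissa z).

Definition marked (x : R) : bool :=
  (x == (Num.truncn x)%:R) && (b || (0 < Num.truncn x)%N).

(** If [b] fails, marked levels start at 1, whence the shift, and the points of level 0 belong to
    the first arc. *)
Definition label (z : T) : nat :=
  let a := Num.truncn (height_fun z) in
  if marked (height_fun z) then (a - ~~ b)%N else (F + b + a)%N.

Lemma height_fun_gam t : `|t| <= k%:R -> height_fun (gam t) = eps `|t|.
Proof. by move=> tk; rewrite /height_fun abscissa_gam. Qed.

Lemma label_abscissa z w : abscissa z = abscissa w -> label z = label w.
Proof. by rewrite /label /height_fun => ->. Qed.

Lemma same_orbit_fold z :
  exists2 t, 0 <= t <= kap & same_orbit label z (gam t).
Proof.
have [w zw wk] : exists2 w, same_orbit label z w & abscissa w <= kap.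
  have /andP[_ zk] := abscissa_bound z.
  case: eps_sym => [kE|[kE sym]].
    by exists z; [exact: same_orbit_refl|rewrite kE].
  have [zkap|zkap] := leP (abscissa z) kap.
    by exists z => //; exact: same_orbit_refl.
  exists (flip z); last by rewrite abscissa_flip -kE mulr2n; lra.
  exists (@flip R k) => //; split; first exact: homeomorphism_flip.
  by move=> w; rewrite /label /height_fun abscissa_flip sym.
have [t tk tw] := gam_surj w.
move: wk; rewrite -tw abscissa_gam// => tkap.
exists `|t|; first by rewrite normr_ge0.
apply: same_orbit_trans zw _; rewrite -tw.
have [t0|t0] := leP 0 t; first by rewrite ger0_norm//; exact: same_orbit_refl.
rewrite ltr0_norm// -mirror_gam//.
exact/same_orbit_mirror/label_abscissa.
Qed.

Lemma eps_range x : 0 <= x <= k%:R -> 0 <= eps x <= F%:R + c%:R / 2.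
Proof.
have main (y : R) : 0 <= y <= kap -> 0 <= eps y <= F%:R + c%:R / 2.
  move=> /andP[y0 yk]; rewrite -eps_kap -{1}eps0; apply/andP; split.
    have [->//|yn] := eqVneq y 0.
    by apply/ltW/eps_mono => //; rewrite lt_neqAle eq_sym yn.
  have [->//|yn] := eqVneq y kap.
  by apply/ltW/eps_mono => //; rewrite lt_neqAle yn.
move=> /andP[x0 xk]; have [xkap|xkap] := leP x kap; first by rewrite main ?x0.
case: eps_sym => [kE|[kE sym]]; first by move: xk; rewrite -kE; lra.
by rewrite -sym main// -kE mulr2n; move: xk; rewrite -kE mulr2n; lra.
Qed.

Lemma height_fun_range z : 0 <= height_fun z <= F%:R + c%:R / 2.
Proof. exact/eps_range/abscissa_bound. Qed.

Lemma height_fun_ge0 z : 0 <= height_fun z.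
Proof. by case/andP: (height_fun_range z). Qed.

Lemma truncn_height z : (Num.truncn (height_fun z) <= F)%N.
Proof.
have /andP[h0 hF] := height_fun_range z.
have /andP[th _] := truncn_itv h0.
rewrite -ltnS -(ltr_nat R) -natr1; apply: le_lt_trans th _.
by apply: le_lt_trans hF _; case: c => /=; lra.
Qed.

Lemma marked_label_lt z : marked (height_fun z) -> (label z < F + b)%N.
Proof.
move=> mz; rewrite /label mz; move/andP: mz => [_]; have := truncn_height z.
by case: b => /=; lia.
Qed.

Lemma F_c_gt0 : (0 < F + c)%N.
Proof.
have : eps 0 < eps kap by exact: eps_mono.
by rewrite eps0 eps_kap; case: F => //; case: c => //; rewrite mul0r addr0 ltxx.
Qed.

(** Off the marked levels the truncated height is [F] only if [c] holds: otherwise [F] is the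
    largest height and is itself marked. *)
Lemma label_le z : (label z < F + F + b + c)%N.
Proof.
case: (boolP (marked (height_fun z))) => mz.
  by have := marked_label_lt mz; have := F_c_gt0; lia.
rewrite /label (negbTE mz).
suff : (Num.truncn (height_fun z) < F + c)%N by lia.
have := truncn_height z; rewrite leq_eqVlt => /orP[/eqP tF|]; last by lia.
rewrite tF -[X in (X < _)%N]addn0 ltn_add2l lt0n; apply: contraNneq mz.
case: c (height_fun_range z) F_c_gt0 => // /andP[h0 hF] Fc _.
have /andP[th _] := truncn_itv h0.
rewrite /marked tF; apply/andP; split; last by apply/orP; right; lia.
by rewrite eq_le -{2}tF th andbT; move: hF; rewrite mul0r addr0.
Qed.

Lemma eps_IVT v : 0 <= v <= F%:R + c%:R / 2 -> exists z, height_fun z = v.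
Proof.
move=> vF; have [//||x + xv] := @IVT R eps 0 kap v (ltW kap_gt0).
- exact: continuous_subspaceT.
- rewrite eps0 eps_kap min_l ?max_r//; by case/andP: vF => /le_trans; apply.
rewrite in_itv/= => /andP[x0 xk]; exists (gam x).
by rewrite height_fun_gam ger0_norm// (le_trans xk).
Qed.

Lemma label_surj m : (m < F + F + b + c)%N -> exists z, label z = m.
Proof.
move=> mn; have [mF|mF] := ltnP m (F + b).
  have [|z hz] := @eps_IVT (m + ~~ b)%:R.
    rewrite ler0n/= (le_trans (_ : _ <= F%:R))//.
      by rewrite ler_nat; case: b mF => /=; lia.
    by rewrite lerDl divr_ge0.
  exists z; rewrite /label /marked hz natrK eqxx addnK /=.
  suff -> : (b || (0 < m + ~~ b)%N) by [].
  by case: b => //=; rewrite addn1.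
(* An arc is represented by its half-integer height; when [c] holds, the last one is the height of
   [kap]. *)
have [|z hz] := @eps_IVT ((m - (F + b))%:R + 2^-1).
  apply/andP; split; first by rewrite addr_ge0// invr_ge0.
  have [lt|[-> ->]] : (m - (F + b) < F)%N \/ (m - (F + b) = F)%N /\ c.
  - by case: c mn => /=; lia.
  - have : (m - (F + b)).+1%:R <= F%:R :> R by rewrite ler_nat.
    by rewrite -natr1; have : 0 <= c%:R :> R by []; lra.
  - by move=> /=; lra.
have tz : Num.truncn (height_fun z) = (m - (F + b))%N.
  by rewrite hz; apply: truncn_def; rewrite -(natr1 (m - (F + b))); lra.
exists z; rewrite /label /marked tz hz.
by rewrite -subr_eq0 addrAC subrr add0r invr_eq0 pnatr_eq0/= subnKC.
Qed.

Lemma height_fun_continuous : continuous height_fun.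
Proof.
move=> z; apply: (@continuous_comp _ _ _ (@abscissa R k) eps).
  exact: abscissa_continuous.
exact: eps_cont.
Qed.

Lemma closed_height_fun (A : set R) : closed A -> closed (height_fun @^-1` A).
Proof. by move=> cA; move/continuous_closedP: height_fun_continuous; apply. Qed.

Lemma closed_marks (P : pred nat) m :
  closed [set z | exists2 a, (a < m)%N & P a /\ height_fun z = a%:R].
Proof.
have -> : [set z | exists2 a, (a < m)%N & P a /\ height_fun z = a%:R] =
    \bigcup_(a in [set a | (a < m)%N /\ P a]) (height_fun @^-1` [set a%:R]).
  apply/seteqP; split=> [z [a am [Pa az]]|z [a [am Pa] az]].
    by exists a.
  by exists a.
apply: closed_bigcup => [|a _]; last first.
  by apply: closed_height_fun; exact: closed_eq.
by apply: sub_finite_set (finite_II m) => a [].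
Qed.

Lemma label_closed m : closed [set z | (label z <= m)%N].
Proof.
have [mF|mF] := ltnP m (F + b).
  suff -> : [set z | (label z <= m)%N] = [set z | exists2 a,
      (a < (m + ~~ b).+1)%N & (b || (0 < a)%N) /\ height_fun z = a%:R].
    exact: (@closed_marks (fun a => b || (0 < a)%N)).
  apply/seteqP; split=> [z /=|z /= [a am [ab az]]].
    rewrite /label; case: ifP => [/andP[/eqP mz az]|_]; last by lia.
    by exists (Num.truncn (height_fun z)) => //; lia.
  by rewrite /label /marked az natrK eqxx ab /=; lia.
(* Once arcs appear, all integer heights are already present, and the arcs fill an initial range of
   heights closed by the next integer. *)
suff -> : [set z | (label z <= m)%N] =
    (height_fun @^-1` [set x | x <= (m - (F + b)).+1%:R]) `|`
    [set z | exists2 a, (a < F.+1)%N & true /\ height_fun z = a%:R].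
  apply: closedU; first by apply: closed_height_fun; exact: closed_le.
  exact: (@closed_marks predT).
apply/seteqP; split=> [z /=|z].
  rewrite /label; case: ifP => [/andP[/eqP mz az] _|_ tm].
    by right; exists (Num.truncn (height_fun z)) => //; rewrite ltnS truncn_height.
  left; have /andP[_ /ltW/le_trans] := truncn_itv (height_fun_ge0 z).
  by apply; rewrite ler_nat; lia.
case: (boolP (marked (height_fun z))) => mz.
  by move=> _ /=; apply: ltnW; apply: leq_trans (marked_label_lt mz) mF.
rewrite /label /= (negbTE mz) => -[zm|[a _ [_ za]]]; last first.
  move: mz; rewrite za /marked natrK eqxx negb_or -leqNgt => /andP[_].
  by lia.
suff : (Num.truncn (height_fun z) < (m - (F + b)).+1)%N by lia.
have /andP[th _] := truncn_itv (height_fun_ge0 z).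
rewrite ltn_neqAle -(ler_nat R) (le_trans th zm) andbT.
apply: contra mz => /eqP tE; rewrite /marked tE orbT andbT eq_le zm.
by rewrite -tE th.
Qed.

(** Fold both points to parameters in [0, [kap]]. Equal marked labels force equal heights; equal arc
    labels put both parameters in an open interval free of glued points, where a push applies. *)
Lemma label_transitive z w : label z = label w -> same_orbit label z w.
Proof.
have main (t t' : R) : 0 <= t -> t < t' -> t' <= kap ->
    label (gam t) = label (gam t') -> same_orbit label (gam t) (gam t').
  move=> t0 tt' tk'; have tk : t <= kap by lra.
  have nt : `|t| <= k%:R by rewrite ger0_norm//; exact: le_trans kap_le.
  have t0' : 0 <= t' by exact: ltW (le_lt_trans t0 tt').
  have nt' : `|t'| <= k%:R by rewrite ger0_norm//; exact: le_trans kap_le.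
  have ht : height_fun (gam t) = eps t by rewrite height_fun_gam// ger0_norm.
  have ht' : height_fun (gam t') = eps t'.
    by rewrite height_fun_gam// ger0_norm.
  have ltt' : eps t < eps t' by exact: eps_mono.
  case: (boolP (marked (eps t))) => mt; case: (boolP (marked (eps t'))) => mt'.
  - move=> eqt; exfalso; move: eqt; rewrite /label ht ht' mt mt'.
    move/andP: mt => [/eqP et bt]; move/andP: mt' => [/eqP et' bt'].
    move=> eqt; move: ltt'; rewrite et et' ltr_nat; move: bt bt' eqt.
    case: b => /=; rewrite ?subn0 ?subn1; first by move=> _ _ ->; rewrite ltnn.
    move=> n0 n0' /(congr1 S).
    by rewrite !prednK// => ->; rewrite ltnn.
  - have := @marked_label_lt (gam t); rewrite ht => /(_ mt) lt ltE; exfalso; move: lt.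
    by rewrite ltE /label ht' (negbTE mt') ltnNge leq_addr.
  - have := @marked_label_lt (gam t'); rewrite ht' => /(_ mt') lt ltE; exfalso; move: lt.
    by rewrite -ltE /label ht (negbTE mt) ltnNge leq_addr.
  rewrite {1 2}/label ht ht' (negbTE mt) (negbTE mt') => /addnI eqa.
  set a := Num.truncn (eps t) in eqa.
  (* When level 0 is unmarked, the first arc continues through parameter 0 to its mirror image; -1
     lies below every height. *)
  pose lo : R := if (a == 0)%N && ~~ b then -1 else a%:R.
  pose O : set R := [set s | `|s| < k%:R /\ lo < eps `|s| < a.+1%:R].
  have O_label s : O s -> label (gam s) = (F + b + a)%N.
    move=> [sk /andP[los sa]].
    have ss : height_fun (gam s) = eps `|s| by rewrite height_fun_gam// ltW.
    have s0 : 0 <= eps `|s| by rewrite -ss height_fun_ge0.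
    have ts : Num.truncn (eps `|s|) = a.
      apply: truncn_def; rewrite sa andbT; move: los; rewrite /lo.
      by case: ifP => [/andP[/eqP -> _] _|_ /ltW].
    rewrite /label ss ts; case: ifP => // /andP[/eqP]; rewrite ts => es ba.
    by move: los; rewrite /lo es; move: ba; case: (a) => [|a'] /=; case: (b);
      rewrite ?ltxx.
  have O_int s i : O s -> (0 < i)%N -> `|s| != i%:R.
    move=> [sk /andP[los sa]] i0; apply/eqP => si.
    have ik : (i < k)%N by rewrite -(ltr_nat R) -si.
    have [|j j0 ej] := @eps_int i; first by rewrite i0.
    move: los sa; rewrite si ej ltr_nat /lo; case: ifP => [/andP[/eqP -> _] _|_].
      by rewrite ltnS leqn0 => /eqP j0'; rewrite j0' in j0.
    by rewrite ltr_nat ltnS => /leq_trans/[apply]; rewrite ltnn.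
  have mem (s : R) : 0 <= s -> s <= kap -> a = Num.truncn (eps s) ->
      ~~ marked (eps s) -> O s.
    move=> s0 sk aE nm; have sk' : s <= k%:R by exact: le_trans kap_le.
    have s0k : 0 <= s <= k%:R by rewrite s0.
    have es0 : 0 <= eps s by case/andP: (eps_range s0k).
    have /andP[ts st] := truncn_itv es0; rewrite -aE in ts st.
    split.
      (* Abscissa k can occur only if [kap] equals k, and then its height [F] is marked. *)
      rewrite ger0_norm// lt_neqAle sk' andbT; apply: contra nm => /eqP se.
      have kE : kap = k%:R by apply/eqP; rewrite eq_le kap_le -se.
      have := F_c_gt0; rewrite se -kE eps_kap (negbTE (eps_end kE)) addn0 => F0.
      by rewrite /marked mul0r addr0 natrK eqxx F0 orbT.
    rewrite ger0_norm// st andbT /lo; case: ifP => [_|/negbT nz]; first by lra.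
    rewrite lt_neqAle ts andbT; apply: contra nm => /eqP es.
    rewrite /marked -aE es eqxx /=; move: nz; case: (b) => //=.
    by rewrite andbT lt0n.
  have Ot : O t by exact: mem.
  have Ot' : O t' by apply: mem => //; lra.
  have Oopen : open O.
    have -> : O = (fun s : R => `|s|) @^-1` [set x | x < k%:R] `&`
        (eps \o (fun s : R => `|s|)) @^-1` `]lo, a.+1%:R[.
      by apply/seteqP; split=> s; rewrite /O /= in_itv.
    apply: openI.
      by apply: open_comp => // s _; exact: norm_continuous.
    apply: open_comp => // s _.
    apply: (@continuous_comp _ _ _ (fun s : R => `|s|) eps).
      exact: norm_continuous.
    exact: eps_cont.
  have Omid (s : R) : t <= s <= t' -> O s.
    move=> /andP[ts st]; have s0 : 0 <= s by lra.
    have [->//|tns] := eqVneq s t; have [->//|snt] := eqVneq s t'.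
    have lts : t < s by rewrite lt_neqAle eq_sym tns.
    have lst : s < t' by rewrite lt_neqAle snt.
    move: Ot Ot' => [_ /andP[l1 _]] [tk2 /andP[_ l2]].
    have e1 : eps t < eps s by apply: eps_mono => //; lra.
    have e2 : eps s < eps t' by apply: eps_mono => //; lra.
    move: l1 l2 tk2; rewrite !ger0_norm// => l1 l2 tk2.
    rewrite /O /= ger0_norm// (lt_trans lst tk2); split=> //.
    by rewrite (lt_trans l1 e1) (lt_trans e2 l2).
  (* Openness leaves room on both sides of [t, t'], even when one of its ends is 0 or [kap]. *)
  have /nbhs_ballP[r r0 rO] : nbhs t O by exact: open_nbhs_nbhs.
  have /nbhs_ballP[r' r0' rO'] : nbhs t' O by exact: open_nbhs_nbhs.
  rewrite /= in r0 r0'.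
  have ab (s : R) : t - r < s < t' + r' -> O s.
    move=> /andP[rs sr]; have [st|ts] := ltP s t.
      by apply: rO; rewrite /ball /= ltr_norml; lra.
    have [st'|ts'] := leP s t'; first by apply: Omid; rewrite ts.
    by apply: rO'; rewrite /ball /= ltr_norml; lra.
  apply: (@same_orbit_push _ _ label (t - r) (t' + r')).
  - by move=> s /ab[].
  - by move=> s i /ab; exact: O_int.
  - by move=> s s' /ab/O_label -> /ab/O_label ->.
  - by apply/andP; split; lra.
  - by apply/andP; split; lra.
have [t /andP[t0 tk] zt] := same_orbit_fold z.
have [t' /andP[t0' tk'] wt] := same_orbit_fold w.
rewrite -(same_orbit_label zt) -(same_orbit_label wt) => tt'.
apply: same_orbit_trans zt _; apply: same_orbit_trans (same_orbit_sym wt).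
have [lt|gt|->] := ltgtP t t'; last exact: same_orbit_refl.
  exact: main.
by apply: same_orbit_sym; apply: main.
Qed.

Lemma label_height_is :
  [/\ forall m, closed [set z | (label z <= m)%N],
      forall m, (m < F + F + b + c)%N -> exists z, label z = m,
      forall z, (label z < F + F + b + c)%N
    & forall z w, label z = label w -> same_orbit label z w].
Proof.
by split; [exact: label_closed|exact: label_surj|exact: label_le|
           exact: label_transitive].
Qed.

End label.

(** * Cut points and invariance *)

Lemma connected_punctured_homeomorphism (T : topologicalType) (g : T -> T) z :
  homeomorphism g -> connected (~` [set z]) -> connected (~` [set g z]).
Proof.
move=> [cg [h [ch [gK hK]]]] cz.
have -> : ~` [set g z] = g @` (~` [set z]).
  apply/seteqP; split=> [w wz|_ [w wz <-] /= gw].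
    exists (h w) => // hw; apply: wz; rewrite /= -(hK w) hw.
    by [].
  by apply: wz; exact: (can_inj gK gw).
apply: connected_continuous_connected => //.
exact: continuous_subspaceT.
Qed.

Section cut_points.
Variables (R : realType) (k : nat).
Local Notation T := (necklace R k).
Local Notation gam := (@gam R k).
Implicit Types z w : T.

Lemma connected_gam (A : set R) : is_interval A -> connected (gam @` A).
Proof.
move=> iA; apply: connected_continuous_connected.
  exact/connected_intervalP.
exact/continuous_subspaceT/gam_continuous.
Qed.

Lemma abscissa_gam_nat (i : nat) : (i <= k)%N -> abscissa (gam i%:R) = i%:R.
Proof. by move=> ik; rewrite abscissa_gam ?normr_nat ?ler_nat. Qed.

Lemma abscissa_nat z i : (i <= k)%N -> abscissa z = i%:R -> z = gam i%:R.
Proof.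
move=> ik; have [t tk <-] := gam_surj z; rewrite abscissa_gam// => ti.
have [t0|t0] := leP 0 t; first by rewrite -ti ger0_norm.
by rewrite -ti ltr0_norm// (gam_opp ik).
Qed.

Lemma gam_endpoints : gam (- k%:R) = gam k%:R.
Proof. by apply: (@gam_opp _ _ _ k); rewrite ?normr_nat. Qed.

Lemma open_abscissa_lt (x : R) : open [set z : T | abscissa z < x].
Proof.
have /continuousP := @abscissa_continuous R k.
by move=> /(_ [set y | y < x]); apply; exact: open_lt.
Qed.

Lemma closed_abscissa_le (x : R) : closed [set z : T | abscissa z <= x].
Proof.
have /continuous_closedP := @abscissa_continuous R k.
by move=> /(_ [set y | y <= x]); apply; exact: closed_le.
Qed.

Definition tangency z := exists2 i, (0 < i < k)%N & z = gam i%:R.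

(** The tangency point is the only point of its abscissa, so the points of smaller abscissa are both
    open and closed in its complement. *)
Lemma tangency_cut z : tangency z -> ~ connected (~` [set z]).
Proof.
move=> [i /andP[i0 ik] ->] cz.
have ei := abscissa_gam_nat (ltnW ik).
have e0 := abscissa_gam_nat (leq0n k).
have ek := abscissa_gam_nat (leqnn k).
have : ~` [set gam i%:R] `&` [set w | abscissa w < i%:R] = ~` [set gam i%:R].
  apply: cz.
  - exists (gam 0); split=> /=.
      by move=> /(congr1 (@abscissa R k)); rewrite ei e0 => /eqP; rewrite eqr_nat; lia.
    by rewrite e0 ltr_nat.
  - exists [set w | abscissa w < i%:R] => //.
    exact: open_abscissa_lt.
  - exists [set w | abscissa w <= i%:R].
      exact: closed_abscissa_le.
    apply/seteqP; split=> w /= [wi wl]; split=> //; first exact: ltW.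
    rewrite lt_neqAle wl andbT; apply/eqP => /(abscissa_nat (ltnW ik)).
    exact: wi.
move=> /seteqP[_ /(_ (gam k%:R))] /=; rewrite ek ltr_nat => -[].
  by move=> /(congr1 (@abscissa R k)); rewrite ei ek => /eqP; rewrite eqr_nat; lia.
by lia.
Qed.

(** Removing the right end leaves the image of an open interval; removing any other such point
    leaves the images of two intervals joined at the right end. *)
Lemma not_tangency_not_cut z : ~ tangency z -> connected (~` [set z]).
Proof.
have [t tk <-] := gam_surj z => nt.
have [tlt|tge] := ltP `|t| k%:R; last first.
  have zE : gam t = gam k%:R.
    by apply: abscissa_nat => //; rewrite abscissa_gam//; apply/eqP; rewrite eq_le tk.
  have -> : ~` [set gam t] = gam @` `]- k%:R, k%:R[.
    apply/seteqP; split=> [w|_ [s + <-]] /=.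
      rewrite zE; have [s sk <-] := gam_surj w => sn; exists s => //.
      rewrite /= in_itv/= -ltr_norml lt_neqAle sk andbT.
      apply/eqP => se; apply: sn; apply: abscissa_nat => //.
      by rewrite abscissa_gam.
    rewrite /= in_itv/= -ltr_norml zE => sk /(congr1 (@abscissa R k)).
    by rewrite abscissa_gam_nat// abscissa_gam// ?ltW// => se; rewrite se ltxx in sk.
  exact/connected_gam/interval_is_interval.
have tkk : - k%:R < t < k%:R by rewrite -ltr_norml.
have uniq s : `|s| <= k%:R -> gam s = gam t -> s = t.
  move=> sk /gam_eq[]// -[tE [i /andP[i0 _] si]]; exfalso; apply: nt.
  have ti : `|t| = i%:R by rewrite tE normrN.
  have ik : (i < k)%N by rewrite -(ltr_nat R) -ti.
  exists i; first by rewrite i0.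
  by apply: abscissa_nat; [exact: ltnW|rewrite abscissa_gam].
have -> : ~` [set gam t] = gam @` `[- k%:R, t[ `|` gam @` `]t, k%:R].
  apply/seteqP; split=> [w|w [] [s + <-]] /=.
  - have [s sk <-] := gam_surj w => sn.
    move: (sk); rewrite ler_norml => /andP[ks sk'].
    have [st|ts|st] := ltgtP s t.
    + by left; exists s => //=; rewrite /= in_itv/= ks.
    + by right; exists s => //=; rewrite /= in_itv/= sk' andbT.
    + by rewrite st in sn.
  - rewrite /= in_itv/= => /andP[ks st].
    have sk : `|s| <= k%:R.
      by rewrite ler_norml ks; case/andP: tkk => _ /(lt_trans st)/ltW.
    by move=> /(uniq _ sk) se; rewrite se ltxx in st.
  - rewrite /= in_itv/= => /andP[ts sk'].
    have sk : `|s| <= k%:R.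
      by rewrite ler_norml sk' andbT; case/andP: tkk => /lt_trans/(_ ts)/ltW.
    by move=> /(uniq _ sk) se; rewrite se ltxx in ts.
apply: connectedU; [|exact/connected_gam/interval_is_interval..].
case/andP: tkk => kt tk'; exists (gam k%:R); split.
  by exists (- k%:R); [rewrite /= in_itv/= lexx|exact: gam_endpoints].
by exists k%:R => //; rewrite /= in_itv/= lexx andbT.
Qed.

Lemma tangency_homeomorphism (g : T -> T) z :
  homeomorphism g -> tangency z -> tangency (g z).
Proof.
move=> [cg [h [ch [gK hK]]]] tz; apply: contrapT => /not_tangency_not_cut cgz.
apply: (tangency_cut tz); rewrite -(gK z).
by apply: connected_punctured_homeomorphism => //; split=> //; exists g.
Qed.

(** * Sides of a tangency point and distance to the ends *)

Lemma left_side_connected i : (i <= k)%N ->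
  connected [set z : T | abscissa z < i%:R].
Proof.
move=> ik; have -> : [set z : T | abscissa z < i%:R] = gam @` `]- i%:R, i%:R[.
  apply/seteqP; split=> [w|_ [s + <-]] /=.
    have [s sk <-] := gam_surj w; rewrite abscissa_gam// => si.
    by exists s => //=; rewrite /= in_itv/= -ltr_norml.
  rewrite /= in_itv/= -ltr_norml => si; rewrite abscissa_gam//.
  by apply/ltW/(lt_le_trans si); rewrite ler_nat.
exact/connected_gam/interval_is_interval.
Qed.

Lemma right_side_connected i : (i < k)%N ->
  connected [set z : T | i%:R < abscissa z].
Proof.
move=> ik; have ikR : i%:R < k%:R :> R by rewrite ltr_nat.
have i0 : 0 <= i%:R :> R by [].
have -> : [set z : T | i%:R < abscissa z] =
    gam @` `[- k%:R, - i%:R[ `|` gam @` `]i%:R, k%:R].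
  apply/seteqP; split=> [w|w [] [s + <-]] /=.
  - have [s sk <-] := gam_surj w; rewrite abscissa_gam// => si.
    move: sk; rewrite ler_norml => /andP[ks sk].
    have [s0|s0] := leP 0 s.
      right; exists s => //=; rewrite /= in_itv/= sk andbT.
      by rewrite -(ger0_norm s0).
    left; exists s => //=; rewrite /= in_itv/= ks/=.
    by move: si; rewrite ltr0_norm// ltrNr.
  - rewrite /= in_itv/= => /andP[ks si].
    have s0 : s <= 0 by apply/ltW/(lt_le_trans si); rewrite oppr_le0.
    have sk : `|s| <= k%:R by rewrite (ler0_norm s0) lerNl.
    by rewrite (abscissa_gam sk) (ler0_norm s0) ltrNr.
  - rewrite /= in_itv/= => /andP[si sk].
    have s0 : 0 <= s by exact/ltW/(le_lt_trans i0).
    have sk' : `|s| <= k%:R by rewrite (ger0_norm s0).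
    by rewrite (abscissa_gam sk') (ger0_norm s0).
apply: connectedU; [|exact/connected_gam/interval_is_interval..].
exists (gam k%:R); split.
  by exists (- k%:R); [rewrite /= in_itv/= lexx ltrN2|exact: gam_endpoints].
by exists k%:R => //; rewrite /= in_itv/= lexx andbT.
Qed.

Definition end_dist (x : R) : R := Num.min x (k%:R - x).

Lemma end_dist_nat i : (i <= k)%N -> end_dist i%:R = (minn i (k - i))%:R.
Proof.
move=> ik; rewrite /end_dist -natrB//.
by rewrite /Order.min ltr_nat /minn; case: ltnP.
Qed.

Lemma end_dist_flip x : end_dist (k%:R - x) = end_dist x.
Proof. by rewrite /end_dist subKr minC. Qed.

Lemma connected_clopenP (U : topologicalType) (A B C : set U) :
  connected A -> open B -> closed C -> A `&` B = A `&` C ->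
  A `&` B !=set0 -> A `<=` B.
Proof.
move=> cA oB cC BC AB0; suff <- : A `&` B = A by move=> x [].
by apply: cA => //; [exists B|exists C].
Qed.

Section ends.
Variable j : nat.
Hypothesis jk : (j.+1 + j.+1 < k)%N.
Hypothesis IH : forall (g : T -> T) z, homeomorphism g -> tangency z ->
  end_dist (abscissa z) <= j%:R -> end_dist (abscissa (g z)) <= j%:R.

(* The homeomorphic image of the left end component is a union of sides of a
   tangency point; counting tangency points forces it to be a short side. *)
Lemma left_end_image (g : T -> T) z : homeomorphism g ->
  abscissa z <= j.+1%:R -> end_dist (abscissa (g z)) <= j.+1%:R.
Proof.
have [i iE] : exists i, i = j.+1 by exists j.+1.
rewrite -iE => hg zj; have ik2 : (i + i < k)%N by rewrite iE.
have [cg [h [ch [gK hK]]]] := hg.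
have hh : homeomorphism h by split=> //; exists g.
have tc : tangency (gam i%:R) by exists i => //; lia.
have [i' /andP[i'0 i'k] gc] := tangency_homeomorphism hg tc.
have ik : (i <= k)%N by lia.
(* [B] is the image under [g] of the left end cut off before abscissa [i], and [C] includes the cut
   point; they differ only at the image [gam i'%:R] of that point. *)
pose B := h @^-1` [set w | abscissa w < i%:R].
pose C := h @^-1` [set w | abscissa w <= i%:R].
have oB : open B.
  move/continuousP: ch => /(_ [set w | abscissa w < i%:R]); apply.
  exact: open_abscissa_lt.
have cC : closed C.
  move/continuous_closedP: ch => /(_ [set w | abscissa w <= i%:R]); apply.
  exact: closed_abscissa_le.
have CB w : abscissa w != i'%:R -> C w -> B w.
  rewrite /C /B /= => wi' wi; rewrite lt_neqAle wi andbT; apply: contra wi'.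
  move=> /eqP e; have hw := abscissa_nat ik e.
  have wE : w = gam i'%:R by rewrite -gc -hw hK.
  by apply/eqP; rewrite wE; exact: (abscissa_gam_nat (ltnW i'k)).
have Bt w : tangency w -> B w -> end_dist (abscissa w) <= j%:R.
  move=> tw Bw; rewrite -(hK w); have th := tangency_homeomorphism hh tw.
  apply: IH => //; case: th Bw => m /andP[m0 mk] hw.
  rewrite /B /= hw (abscissa_gam_nat (ltnW mk)) ltr_nat => mi.
  rewrite (end_dist_nat (ltnW mk)) ler_nat.
  by apply: leq_trans (geq_minl _ _) _; rewrite -ltnS -iE.
(* By connectedness [B] contains the whole side of [gam i'%:R] in which [w] lies. A side too long
   would contain the tangency point at [i], or at [k - i] on the right, whose end distance [i]
   exceeds the bound [j] valid in [B]. *)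
have side w : B w -> end_dist (abscissa w) <= i%:R /\ ((i' <= i)%N \/ (k - i <= i')%N).
  move=> Bw; have /lt_total/orP[wl|wr] : abscissa w != i'%:R.
  - apply/eqP => /(abscissa_nat (ltnW i'k)) wE; move: Bw.
    by rewrite /B /= wE -gc gK (abscissa_gam_nat ik) ltxx.
  - have LB : [set w | abscissa w < i'%:R] `<=` B.
      apply: (connected_clopenP (left_side_connected (ltnW i'k)) oB cC).
        apply/seteqP; split=> v /= [vl vB]; split=> //; first exact: ltW.
        by apply: CB => //; rewrite lt_eqF.
      by exists w.
    have i'i : (i' <= i)%N.
      rewrite leqNgt; apply/negP => ii'.
      have Bc : B (gam i%:R) by apply: LB; rewrite /= (abscissa_gam_nat ik) ltr_nat.
      move: (Bt _ tc Bc).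
      rewrite (abscissa_gam_nat ik) (end_dist_nat ik) ler_nat.
      by move: ik2 iE; clear; lia.
    split; last by left.
    rewrite /end_dist ge_min; apply/orP; left.
    by apply: ltW (lt_le_trans wl _); rewrite ler_nat.
  - have RB : [set w | i'%:R < abscissa w] `<=` B.
      apply: (connected_clopenP (right_side_connected i'k) oB cC).
        apply/seteqP; split=> v /= [vl vB]; split=> //; first exact: ltW.
        by apply: CB => //; rewrite gt_eqF.
      by exists w.
    have kk : (k - i <= k)%N by lia.
    have ki' : (k - i <= i')%N.
      rewrite leqNgt; apply/negP => ii'.
      have tk : tangency (gam (k - i)%:R) by exists (k - i)%N => //; lia.
      have Bk : B (gam (k - i)%:R).
        by apply: RB; rewrite /= (abscissa_gam_nat kk) ltr_nat.
      move: (Bt _ tk Bk).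
      rewrite (abscissa_gam_nat kk) (end_dist_nat kk) ler_nat.
      by move: ik2 iE; clear; lia.
    split; last by right.
    have : (k - i)%:R <= i'%:R :> R by rewrite ler_nat.
    rewrite (natrB _ ik) /end_dist ge_min => ki; apply/orP; right.
    by rewrite lerBlDl -lerBlDr; exact: le_trans ki (ltW wr).
move: zj; rewrite le_eqVlt => /orP[/eqP/(abscissa_nat ik) ->|zi]; last first.
  have Bg : B (g z) by rewrite /B /= gK.
  by case: (side _ Bg).
(* Here [z] is the cut point itself; applying [side] to the image of the left end locates [i']. *)
rewrite gc (abscissa_gam_nat (ltnW i'k)) (end_dist_nat (ltnW i'k)) ler_nat.
have Bg : B (g (gam 0)).
  by rewrite /B /= gK (abscissa_gam_nat (leq0n k)) ltr_nat iE.
have [_] := side _ Bg.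
by move: i'k; clear; lia.
Qed.

End ends.

(** Induction on [j], starting from the absence of tangency points at end distance 0. The right end
    reduces to the left one by [flip], and the bound is trivial once it reaches k / 2. The bound 0
    is left out because homeomorphisms may move the ends. *)
Lemma end_dist_homeomorphism (g : T -> T) z j : homeomorphism g ->
  end_dist (abscissa z) <= j.+1%:R -> end_dist (abscissa (g z)) <= j.+1%:R.
Proof.
have ends i : (forall (g : T -> T) z, homeomorphism g -> tangency z ->
      end_dist (abscissa z) <= i%:R -> end_dist (abscissa (g z)) <= i%:R) ->
    forall (g : T -> T) z, homeomorphism g ->
    end_dist (abscissa z) <= i.+1%:R -> end_dist (abscissa (g z)) <= i.+1%:R.
  move=> IH {}g {}z hg.
  have [ik|ik] := ltnP (i.+1 + i.+1) k; last first.
    move=> _; have : k%:R <= (i.+1 + i.+1)%:R :> R by rewrite ler_nat.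
    rewrite natrD /end_dist ge_min => ?.
    by case: (leP (abscissa (g z)) i.+1%:R) => //= ?; lra.
  rewrite {1}/end_dist ge_min => /orP[|zj]; first exact: left_end_image.
  rewrite -(@flipK R k z); apply: (left_end_image ik IH (g := g \o @flip R k)).
    by apply: homeomorphism_comp => //; exact: homeomorphism_flip.
  by rewrite abscissa_flip.
elim: j g z => [|j IH] g z; apply: ends => {}g {}z hg.
  move=> [i /andP[i0 ik] ->].
  rewrite (abscissa_gam_nat (ltnW ik)) (end_dist_nat (ltnW ik)) ler_nat.
  by move: i0 ik; clear; lia.
by move=> _; exact: IH.
Qed.

End cut_points.

(** * Heights of the necklace *)

Section labels.
Variables (R : realType).

(* Slope N.+1 on the end circle and slope 1 further inside: the integer values
   are the tangency points together with N extra levels on the end circle. *)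
Definition end_scale (k N : nat) (x : R) : R :=
  Num.min (N.+1%:R * end_dist k x) (end_dist k x + N%:R).

Lemma end_scale0 k x : end_scale k 0 x = end_dist k x.
Proof. by rewrite /end_scale mul1r addr0 minxx. Qed.

Lemma end_dist_id k (x : R) : x *+ 2 <= k%:R -> end_dist k x = x.
Proof. by rewrite mulr2n => xk; rewrite /end_dist min_l// lerBrDr. Qed.

Lemma end_dist_continuous k : continuous (@end_dist R k).
Proof.
move=> x; suff : {for x, continuous (@end_dist R k)} by [].
apply: (@continuous_min _ _ id (fun x => k%:R - x)); first exact: cvg_id.
by apply: (@continuousB R R R (cst k%:R) id x); [exact: cst_continuous|exact: cvg_id].
Qed.

Lemma end_scale_continuous k N : continuous (end_scale k N).
Proof.
move=> x; suff : {for x, continuous (end_scale k N)} by [].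
have cd : {for x, continuous (@end_dist R k)} by exact: end_dist_continuous.
apply: (@continuous_min _ _ (fun x => N.+1%:R * end_dist k x)
                            (fun x => end_dist k x + N%:R)).
  by apply: continuousM => //; exact: cst_continuous.
by apply: continuousD => //; exact: cst_continuous.
Qed.

Lemma end_scale_nat k N i : (0 < i < k)%N ->
  end_scale k N i%:R = (minn i (k - i) + N)%:R.
Proof.
move=> /andP[i0 ik]; rewrite /end_scale (end_dist_nat R (ltnW ik)).
have : (0 < minn i (k - i))%N by rewrite leq_min i0 subn_gt0.
move: (minn _ _) => m m0; rewrite -natrM -natrD min_r// ler_nat.
by rewrite mulSn leq_add2l leq_pmulr.
Qed.

(** Folding at k / 2 leaves [k./2] tangency levels and [N] extra ones. For odd [k] an arc of the
    middle circle remains beyond the last mark, so [c] is [odd k]. *)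
Lemma necklace_label (k N : nat) (b : bool) : (1 < k)%N ->
  let l := @label R k (end_scale k N) (k./2 + N) b in
  [/\ forall m, closed [set z | (l z <= m)%N],
      forall m, (m < k + N.*2 + b)%N -> exists z, l z = m,
      forall z, (l z < k + N.*2 + b)%N
    & forall z w, l z = l w -> same_orbit l z w].
Proof.
move=> k1 l; have -> : (k + N.*2 + b = k./2 + N + (k./2 + N) + b + odd k)%N.
  by rewrite -[X in (X + _ + _)%N]odd_double_half -!addnn; lia.
have k2 : 2 <= k%:R :> R by rewrite ler_nat.
have hk (x : R) : x <= k%:R / 2 -> end_dist k x = x.
  by move=> xk; apply: end_dist_id; rewrite mulr2n; lra.
have N0 : 0 <= N%:R :> R by [].
apply: (@label_height_is _ _ _ (k%:R / 2)).
- exact: end_scale_continuous.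
- rewrite /end_scale hk; last by lra.
  by rewrite mulr0 add0r min_l.
- by lra.
- by lra.
- move=> x y x0 xy yk; rewrite /end_scale !hk//; last by lra.
  rewrite lt_min !gt_min; apply/andP; split; apply/orP.
    by left; rewrite ltr_pM2l.
  by right; rewrite ltrD2r.
- rewrite /end_scale hk// min_r; last first.
    rewrite -(natr1 N) mulrDl mul1r [leLHS]addrC lerD2r ler_peMr//.
    by lra.
  rewrite -[in X in X / 2](odd_double_half k) -muln2 !natrD natrM.
  lra.
- right; split; first by rewrite mulr2n; lra.
  by move=> x; rewrite /end_scale end_dist_flip.
- by move=> kE; exfalso; lra.
- move=> i ik; exists (minn i (k - i) + N)%N; last exact: end_scale_nat.
  by move/andP: ik => [i0 ik]; rewrite ltn_addr// leq_min i0 subn_gt0.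
Qed.

(** The scale is not symmetric under [flip], so only [mirror] folds: there are [N.+1] positive
    marked levels, the last at abscissa 1. At least two labels arise; a single label needs
    [circle_homogeneous]. *)
Lemma circle_label (N : nat) (b : bool) :
  let l := @label R 1 (fun x => N.+1%:R * x) N.+1 b in
  [/\ forall m, closed [set z | (l z <= m)%N],
      forall m, (m < N.+1.*2 + b)%N -> exists z, l z = m,
      forall z, (l z < N.+1.*2 + b)%N
    & forall z w, l z = l w -> same_orbit l z w].
Proof.
move=> l; have -> : (N.+1.*2 + b = N.+1 + N.+1 + b + false)%N.
  by rewrite -addnn addn0.
apply: (@label_height_is _ _ _ 1) => //.
- exact: mulrl_continuous.
- by rewrite mulr0.
- by move=> x y _ xy _; rewrite ltr_pM2l.
- by rewrite mulr1 mul0r addr0.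
- by left.
- by move=> i; lia.
Qed.

(** Pushes inside (-1, 1) reach every point but the glued one, which [flip] exchanges with the left
    end. *)
Lemma circle_homogeneous (z w : necklace R 1) :
  same_orbit (fun=> 0%N) z w.
Proof.
suff main (v : necklace R 1) : same_orbit (fun=> 0%N) (gam 1 0) v.
  exact: same_orbit_trans (same_orbit_sym (main z)) (main w).
have inner (t : R) : `|t| < 1 -> same_orbit (fun=> 0%N) (gam 1 0) (gam 1 t).
  rewrite ltr_norml => t1.
  apply: (@same_orbit_push _ _ _ (-1) 1) => //.
  - by move=> s s1; rewrite ltr_norml.
  - move=> s i s1 i0; apply: contraTneq s1 => si.
    by rewrite -ltr_norml si -leNgt ler1n.
  - by rewrite ltrN10 ltr01.
have [t + <-] := gam_surj v; rewrite le_eqVlt => /orP[/eqP t1|]; last exact: inner.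
exists (@flip R 1); first by split=> //; exact: homeomorphism_flip.
rewrite (@abscissa_nat R 1 (gam 1 t) 1)//; last by rewrite abscissa_gam t1.
apply: abscissa_nat => //; rewrite abscissa_flip.
by rewrite (abscissa_gam_nat R (leq0n 1)) subr0.
Qed.

(** Each extra level adds one mark and one arc, hence two labels; marking level 0 or not adjusts the
    parity. *)
Lemma necklace_heights (k n : nat) : (0 < k)%N -> (k <= n.+1)%N ->
  exists l : necklace R k -> nat,
  [/\ forall m, closed [set z | (l z <= m)%N],
      forall m, (m <= n)%N -> exists z, l z = m,
      forall z, (l z <= n)%N
    & forall z w, l z = l w -> same_orbit l z w].
Proof.
have [k1 _ kn|k1 k0 _] := ltnP 1 k.
  have [cl sl ll ol] := @necklace_label k (n.+1 - k)./2 (odd (n.+1 - k)) k1.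
  set l := label _ _ _ in cl sl ll ol.
  have nE : (k + (n.+1 - k)./2.*2 + odd (n.+1 - k) = n.+1)%N.
    by rewrite -addnA [X in (k + X)%N]addnC odd_double_half subnKC.
  by rewrite nE in sl ll; exists l.
have -> : k = 1%N by lia.
case: n => [|n].
  exists (fun=> 0%N); split=> //.
  - by move=> m; rewrite leqn0 => /eqP ->; exists (gam 1 0).
  - by move=> z w _; exact: circle_homogeneous.
have [cl sl ll ol] := @circle_label n./2 (odd n).
set l := label _ _ _ in cl sl ll ol.
have nE : (n./2.+1.*2 + odd n = n.+2)%N.
  by rewrite doubleS !addSn addnC odd_double_half.
by rewrite nE in sl ll; exists l.
Qed.

(** * A chain of length k - 1 for every group *)

Lemma marked_tangency k (z : necklace R k) : tangency z <->
  marked false (height_fun (end_scale k 0) z).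
Proof.
rewrite /marked /height_fun end_scale0; split=> [[i /andP[i0 ik] ->]|].
  rewrite (abscissa_gam_nat R (ltnW ik)) (end_dist_nat R (ltnW ik)) natrK eqxx.
  by rewrite leq_min i0 subn_gt0.
move: (Num.truncn _) => a /andP[/eqP xa /= a0]; move: xa.
have /andP[x0 xk] := abscissa_bound z; set x := abscissa z in x0 xk *.
have ak : end_dist k x = a%:R -> (a + a <= k)%N.
  rewrite /end_dist => xa; rewrite -(ler_nat R) natrD -xa.
  by rewrite -[leRHS](subrKC x) lerD// ge_min lexx ?orbT.
move=> xa; have {}ak := ak xa; move: xa; rewrite /end_dist.
case: (leP x (k%:R - x)) => [_ xa|_ xa].
  exists a; first by rewrite a0; move: a0 ak; clear; lia.
  by apply: abscissa_nat => //; move: ak; clear; lia.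
exists (k - a)%N; first by move: a0 ak; clear; lia.
apply: abscissa_nat; first exact: leq_subr.
rewrite natrB -?xa ?subKr//; move: ak; clear; lia.
Qed.

(** Marked points are tangency points and go to tangency points no farther from the ends. For an
    unmarked point the truncated height could grow only by reaching the next integer exactly, and
    the image would then be marked. *)
Lemma end_dist_label_le k (g : necklace R k -> necklace R k) z :
  homeomorphism g ->
  (label (end_scale k 0) (k./2 + 0) false (g z) <=
   label (end_scale k 0) (k./2 + 0) false z)%N.
Proof.
move=> hg; set e : necklace R k -> R := height_fun (end_scale k 0).
have eE w : e w = end_dist k (abscissa w) by rewrite /e /height_fun end_scale0.
have e0 w : 0 <= e w.
  have /andP[x0 xk] := abscissa_bound w.
  by rewrite eE /end_dist le_min x0 subr_ge0.
have emono j : e z <= j.+1%:R -> (Num.truncn (e (g z)) <= j.+1)%N.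
  move=> zj; have /andP[tg _] := truncn_itv (e0 (g z)).
  rewrite -(ler_nat R); apply: le_trans tg _.
  by rewrite eE; apply: end_dist_homeomorphism => //; rewrite -eE.
rewrite /label -/e; case: (boolP (marked false (e z))) => mz.
  have -> : marked false (e (g z)).
    by apply/marked_tangency/tangency_homeomorphism => //; exact/marked_tangency.
  move: mz => /andP[/eqP ez /= z0]; apply: leq_sub2r.
  move: ez z0; case: (Num.truncn (e z)) => // j ez _.
  by apply: emono; rewrite ez.
have /andP[_ /ltW/emono tg] := truncn_itv (e0 z).
case: (boolP (marked false (e (g z)))) => mg.
  by move: tg; clear; lia.
rewrite leq_add2l; move: tg; rewrite leq_eqVlt => /orP[/eqP tg|//].
exfalso; move/negP: mg; apply; rewrite /marked tg andbT eq_le.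
have /andP[tl _] := truncn_itv (e0 (g z)); rewrite -{2}tg tl andbT.
rewrite eE; apply: end_dist_homeomorphism => //; rewrite -eE.
by have /andP[_ /ltW] := truncn_itv (e0 z).
Qed.

Lemma necklace_has_chain k (G : set (necklace R k -> necklace R k)) :
  (0 < k)%N -> homeo_subgroup G -> has_chain G k.-1.
Proof.
move=> k0 [hG _]; have [k1|k1] := ltnP 1 k; last first.
  have -> : k.-1 = 0%N by lia.
  exists (fun=> setT); split=> [i _|]; last by split.
  by split; [exact: closedT|split=> //; exists (gam k 0)].
have [cl sl ll _] := @necklace_label k 0 false k1.
apply: (@has_chain_label _ _ (label (end_scale k 0) (k./2 + 0) false)) => //.
- by move=> g z Gg; apply: end_dist_label_le => //; exact: hG.
- by move=> c ck; apply: sl; rewrite addn0; lia.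
- by move=> z; have := ll z; rewrite !addn0; lia.
Qed.

End labels.

Theorem theorem5p6 (R : realType) (p : nat) :
  exists T : pseudoMetricType R,
    topological_graph T /\
    forall h : option nat,
      in_Ph T h <-> match h with None => True | Some n => (p <= n)%N end.
Proof.
exists (necklace R p.+1); split; first exact: necklace_graph.
case=> [n|]; split=> //.
- move=> [G [hG [_ /(_ p)]]]; apply.
  exact: (@necklace_has_chain R p.+1).
- move=> pn; have [l [cl sl ll ol]] := @necklace_heights R p.+1 n isT pn.
  exists (label_group l); split; first exact: homeo_subgroup_label_group.
  exact: label_height.
- move=> _; exists [set id]; split; first exact: homeo_subgroup1.
  (* Labellings exist only with at least [p.+1] values, so a chain of length at least [p] is built
     and then shortened. *)
  move=> n; apply: (@has_chain_leq _ _ _ (maxn n p)); first exact: leq_maxl.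
  have [l [cl sl ll _]] := @necklace_heights R p.+1 (maxn n p) isT (leq_maxr _ _).
  by apply: (@has_chain_label _ _ l) => // g z ->.
Qed.
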